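(* Let $\mathcal{H}$ be a Hilbert space (not necessarily finite dimensional) over $\mathbb{K}$, where $\mathbb{K}=\mathbb{R}$ or $\mathbb{C}$. Let $\phi:(0,1]\to(0,\infty)$ be a continuous, decreasing function satisfying $\phi(xy)\leq \phi(x)\phi(y)$ for all $x,y\in(0,1]$. Let $(\Omega,\mu)$ and $(\Delta,\nu)$ be measure spaces, and let $\{\tau_\alpha\}_{\alpha\in\Omega}$ and $\{\omega_\beta\}_{\beta\in\Delta}$ be 1-bounded continuous Parseval frames for $\mathcal{H}$. Then for every $h\in\mathcal{H}_\tau\cap\mathcal{H}_\omega$, $$S_{\tau,\phi}(h)\,S_{\omega,\phi}(h)\;\geq\;\phi\left(\frac{\left(1+\sup_{\alpha\in\Omega,\,\beta\in\Delta}|\langle\tau_\alpha,\omega_\beta\rangle|\right)^2}{4}\right)\;\geq\;0.$$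
   Context: Let $(\Omega,\mu)$ be a measure space and $\mathcal{H}$ a Hilbert space over $\mathbb{K}$ ($\mathbb{K}=\mathbb{R}$ or $\mathbb{C}$). A collection $\{\tau_\alpha\}_{\alpha\in\Omega}$ in $\mathcal{H}$ is a continuous Parseval frame for $\mathcal{H}$ if (i) for each $h\in\mathcal{H}$ the map $\Omega\ni\alpha\mapsto\langle h,\tau_\alpha\rangle\in\mathbb{K}$ is measurable, and (ii) $\|h\|^2=\int_\Omega|\langle h,\tau_\alpha\rangle|^2\,d\mu(\alpha)$ for all $h\in\mathcal{H}$. It is 1-bounded if $\|\tau_\alpha\|\leq 1$ for all $\alpha\in\Omega$. For a 1-bounded continuous Parseval frame $\{\tau_\alpha\}_{\alpha\in\Omega}$ for $\mathcal{H}$, set $$\mathcal{H}_\tau:=\{h\in\mathcal{H}:\ \|h\|=1,\ \langle h,\tau_\alpha\rangle\neq 0\ \text{for all }\alpha\in\Omega\}.$$ Given a function $\phi:(0,1]\to(0,\infty)$ that is continuous, decreasing and satisfies $\phi(xy)\leq\phi(x)\phi(y)$ for all $x,y\in(0,1]$, the entropy is defined by $$S_{\tau,\phi}(h):=\int_\Omega|\langle h,\tau_\alpha\rangle|^2\,\phi\left(|\langle h,\tau_\alpha\rangle|^2\right)d\mu(\alpha),\qquad h\in\mathcal{H}_\tau,$$ the integral of a nonnegative measurable function, with value in $[0,\infty]$. The set $\mathcal{H}_\omega$ and the quantity $S_{\omega,\phi}(h)$ are defined in the same way for $\{\omega_\beta\}_{\beta\in\Delta}$ and the measure space $(\Delta,\nu)$.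 *)

(* Defs.v *)
From HB Require Import structures.
From mathcomp Require Import all_boot all_order all_algebra.
From mathcomp Require Import all_classical all_reals all_analysis.
From mathcomp Require Import complex.

Set Implicit Arguments.
Unset Strict Implicit.
Unset Printing Implicit Defensive.

Import Order.TTheory GRing.Theory Num.Theory.
Import numFieldNormedType.Exports.

Local Open Scope classical_set_scope.
Local Open Scope ring_scope.

Variant scalar_kind := RealScalars | ComplexScalars.

Definition scalar_field (R : realType) (k : scalar_kind) : numFieldType :=
  match k with
  | RealScalars => R
  | ComplexScalars => R[i]
  end.

Definition scalar_conj (R : realType) (k : scalar_kind) :
    {rmorphism scalar_field R k -> scalar_field R k} :=
  match k with
  | RealScalars => idfun
  | ComplexScalars => Num.conj
  end.

Definition scalar_re (R : realType) (k : scalar_kind) : scalar_field R k -> R :=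
  match k with
  | RealScalars => idfun
  | ComplexScalars => fun z => complex.Re z
  end.

(* In MathComp the norm of a normed space over a numFieldType K takes its values
   in K, here in the copy of R inside K; normR is the same norm with values in
   R. It applies to vectors and, with V := scalar_field R k, to scalars. *)
Definition normR (R : realType) (k : scalar_kind)
    (V : normedZmodType (scalar_field R k)) (v : V) : R :=
  scalar_re `|v|.

Section frames.
Context (R : realType) (k : scalar_kind) (H : completeNormedModType (scalar_field R k)).
(* ip is linear in its first argument and conjugate linear in the second. *)
Variable ip : {dot H for scalar_conj R k}.
Context (d : measure_display) (Omega : measurableType d).
Variables (mu : {measure set Omega -> \bar R}) (tau : Omega -> H).

(* Measurability is for the Borel sigma-algebra of the scalar field. *)
Definition continuous_parseval_frame : Prop :=
  (forall h : H, measurable_fun [set: Omega]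
     ((fun a => ip h (tau a)) :
        Omega -> g_sigma_algebraType (@open (scalar_field R k)))) /\
  (forall h : H,
     ((normR h ^+ 2)%:E = \int[mu]_(a in [set: Omega])
        (normR (ip h (tau a)) ^+ 2)%:E)%E).

Definition one_bounded : Prop := forall a, normR (tau a) <= 1.

Definition entropy_domain : set H :=
  [set h | normR h = 1 /\ forall a, ip h (tau a) != 0].

Definition entropy (phi : R -> R) (h : H) : \bar R :=
  (\int[mu]_(a in [set: Omega])
     (normR (ip h (tau a)) ^+ 2 * phi (normR (ip h (tau a)) ^+ 2))%:E)%E.

End frames.

(* Main.v *)
(* Put p a = |<h, tau_a>|^2 and q b = |<h, omega_b>|^2; these are probability
   densities with values in ]0, 1]. Buzano's inequality, which is Cauchy-Schwarz
   after a reflection in the line of h, gives p a * q b <= ((1 + s) / 2)^2, so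
   phi (p a) * phi (q b) >= phi (p a * q b) >= phi ((1 + s)^2 / 4). Integrating
   against q and then against p gives the product of the entropies; the integrals
   stay iterated, so the product measure never enters. *)
Require Import Defs.
From HB Require Import structures.
From mathcomp Require Import all_boot all_order all_algebra.
From mathcomp Require Import all_classical all_reals all_analysis.
From mathcomp Require Import measurable_realfun complex.
From mathcomp Require Import ring lra.
Import Order.TTheory GRing.Theory Num.Theory.
Import numFieldNormedType.Exports.
Local Open Scope classical_set_scope.
Local Open Scope ring_scope.

Set Implicit Arguments.
Unset Strict Implicit.

(** * Inner product inequalities: Cauchy-Schwarz and Buzano *)

Section inner_product.
Context (K : numFieldType) (theta : {rmorphism K -> K}) (H : normedModType K)
  (ip : {dot H for theta}).
Hypothesis mul_theta : forall c, c * theta c = `|c| ^+ 2.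
Hypothesis ip_norm : forall h : H, `|h| ^+ 2 = ip h h.

Lemma ipC x y : ip x y = theta (ip y x).
Proof. by rewrite [LHS]hermC expr0 mul1r. Qed.

(* [linearBl] and the like change the head of [ip x y] to the underlying bilinear
   form; these restatements keep it in the form used by the hypotheses. *)
Lemma ipDl x y z : ip (x + y) z = ip x z + ip y z.
Proof. exact: linearDl. Qed.

Lemma ipBl x y z : ip (x - y) z = ip x z - ip y z.
Proof. exact: linearBl. Qed.

Lemma ipBr x y z : ip x (y - z) = ip x y - ip x z.
Proof. exact: linearBr. Qed.

Lemma ipZl c x y : ip (c *: x) y = c * ip x y.
Proof. exact: (linearZl_LR ip). Qed.

Lemma ipZr c x y : ip x (c *: y) = theta c * ip x y.
Proof. exact: (linearZr_LR ip). Qed.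

(** [theta] preserves norms: take norms on both sides of [mul_theta] and cancel the norm of a
    nonzero [c]. *)
Lemma norm_ipC x y : `|ip x y| = `|ip y x|.
Proof.
rewrite ipC; set c := ip y x; have [->|c0] := eqVneq c 0; first by rewrite rmorph0.
have nc0 : `|c| != 0 by rewrite normr_eq0.
by apply: (mulfI nc0); rewrite -normrM mul_theta normrX normr_id expr2.
Qed.

Lemma sqr_norm_sub (a b : K) (x y : H) :
  `|a *: x - b *: y| ^+ 2 = `|a| ^+ 2 * `|x| ^+ 2 + `|b| ^+ 2 * `|y| ^+ 2
    - (a * theta b * ip x y + theta a * b * theta (ip x y)).
Proof.
rewrite !ip_norm ipBl !ipBr.
by rewrite !(ipZl, ipZr) -!mul_theta -(ipC y x); ring.
Qed.

Lemma cauchy_schwarz x y : `|ip x y| <= `|x| * `|y|.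
Proof.
have [->|y0] := eqVneq y 0; first by rewrite linear0r normr0 mulr_ge0.
have ny0 : 0 < `|y| ^+ 2 by rewrite exprn_gt0// normr_gt0.
rewrite -(@ler_pXn2r _ 2) ?nnegrE ?mulr_ge0// -subr_ge0 -(pmulr_rge0 _ ny0).
(* This vector is [|y|^2] times the component of [x] orthogonal to [y], a scaling that avoids
   division; its squared norm is [|y|^2 * (|x|^2 * |y|^2 - |<x, y>|^2)]. *)
have := exprn_ge0 2 (normr_ge0 (`|y| ^+ 2 *: x - ip x y *: y)).
congr (0 <= _); rewrite sqr_norm_sub normrX normr_id.
have -> : theta (`|y| ^+ 2) = `|y| ^+ 2 by rewrite ip_norm -ipC.
rewrite -[_ * theta _ * ip x y]mulrA [theta _ * ip _ _]mulrC -!mulrA !mul_theta.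
by ring.
Qed.

(* Cauchy-Schwarz for the reflection [2 <x, h> h - x], which has the norm of [x]. *)
Lemma buzano h x y : `|h| = 1 ->
  2 * (`|ip x h| * `|ip h y|) <= `|x| * `|y| + `|ip x y|.
Proof.
(* The factor [1] gives [z] the shape required by [sqr_norm_sub]. *)
move=> h1; set z := (2 * ip x h) *: h - 1 *: x.
have zx : `|z| = `|x|.
  apply/eqP; rewrite -(@eqrXn2 _ 2)//; apply/eqP.
  rewrite sqr_norm_sub h1 normrM normr1 rmorph1 exprMn -!mul_theta.
  by rewrite !rmorphM !rmorph_nat -!ipC; ring.
have -> : 2 * (`|ip x h| * `|ip h y|) = `|ip z y + ip x y|.
  by rewrite -ipDl /z scale1r subrK ipZl !normrM normr_nat mulrA.
by rewrite (le_trans (ler_normD _ _))// lerD2r -zx cauchy_schwarz.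
Qed.

End inner_product.

(** * Real and complex scalars treated uniformly *)

Section scalars.
Context (R : realType) (k : scalar_kind).
Local Notation K := (scalar_field R k).

(** Norms take values in the scalar field, whereas [phi] and the integrands live in [R];
    inequalities are transferred along this order embedding. *)
Definition scalar_of : {rmorphism R -> scalar_field R k} :=
  match k with
  | RealScalars => idfun
  | ComplexScalars => real_complex R
  end.

Lemma ler_scalar_of : {mono scalar_of : x y / x <= y}.
Proof. by rewrite /scalar_of; case: k => x y //=; rewrite lecR. Qed.

Lemma ltr_scalar_of : {mono scalar_of : x y / x < y}.
Proof. exact: leW_mono ler_scalar_of. Qed.

Lemma scalar_of_norm x : scalar_of `|x| = `|scalar_of x|.
Proof.
rewrite /scalar_of; case: k => //=.
by rewrite normc_def/= expr0n addr0 sqrtr_sqr.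
Qed.

Lemma scalar_reK (z : K) : z \is Num.real -> scalar_of (scalar_re z) = z.
Proof. by move: z; rewrite /scalar_of /scalar_re; case: k => //= z /RRe_real. Qed.

Lemma scalar_of_normR (V : normedZmodType K) (v : V) :
  scalar_of (normR v) = `|v|.
Proof. by rewrite scalar_reK// normr_real. Qed.

Lemma mul_scalar_conj (c : K) : c * scalar_conj R k c = `|c| ^+ 2.
Proof.
move: c; rewrite /scalar_conj; case: k => /= c; last by rewrite normCK.
by rewrite -expr2 real_normK// num_real.
Qed.

(** The norm is 1-Lipschitz by the reverse triangle inequality; the radius [e] is carried into the
    scalar field. *)
Lemma continuous_normR : continuous (fun c : K => normR c : R).
Proof.
move=> c; apply/(@cvgrPdist_lt _ _ _ (nbhs c) (nbhs_filter c)) => e e0.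
apply/nbhs_ballP; exists (scalar_of e) => [|z /=].
  by rewrite /= -(rmorph0 scalar_of) ltr_scalar_of.
rewrite -ball_normE /= => cz; rewrite -ltr_scalar_of.
by rewrite scalar_of_norm rmorphB !scalar_of_normR (le_lt_trans (ler_dist_dist _ _)).
Qed.

(** Open intervals generate the Borel sets of [R], and by continuity their preimages in the scalar
    field are open. *)
Lemma measurable_normR d (T : measurableType d)
    (f : T -> g_sigma_algebraType (@open K)) :
  measurable_fun setT f -> measurable_fun setT (fun t => normR (f t : K)).
Proof.
move=> mf.
apply: (measurability _ (RGenOpens.measurableE R)).
move=> _ [_ [a [b ->]] <-].
apply: (mf measurableT [set x : K | normR x \in `]a, b[]).
apply: sub_sigma_algebra.
have /continuousP/(_ `]a, b[%classic) := continuous_normR.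
by apply; exact: interval_open.
Qed.

End scalars.

(** * Integral inequality for two probability densities *)

Lemma prod_entropy_ge (R : realType) (phi : R -> R)
    (phi_gt0 : forall x, x \in `]0, 1] -> 0 < phi x)
    (phi_meas : measurable_fun (`]0, 1] : set R) phi)
    (phi_submul : forall x y, x \in `]0, 1] -> y \in `]0, 1] ->
      phi (x * y) <= phi x * phi y)
    (dO dD : measure_display)
    (Omega : measurableType dO) (mu : {measure set Omega -> \bar R})
    (Delta : measurableType dD) (nu : {measure set Delta -> \bar R})
    (p : Omega -> R) (q : Delta -> R) (c : R)
    (mp : measurable_fun setT p) (mq : measurable_fun setT q)
    (p01 : forall a, p a \in `]0, 1]) (q01 : forall b, q b \in `]0, 1])
    (p1 : (\int[mu]_a (p a)%:E = 1)%E) (q1 : (\int[nu]_b (q b)%:E = 1)%E)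
    (c_ge0 : 0 <= c) (c_le : forall a b, c <= phi (p a * q b)) :
  (c%:E <= (\int[mu]_a (p a * phi (p a))%:E) *
           (\int[nu]_b (q b * phi (q b))%:E))%E.
Proof.
have gt0 (x : R) : x \in `]0, 1] -> 0 < x by rewrite in_itv/= => /andP[].
have mphi d (T : measurableType d) (f : T -> R) : measurable_fun setT f ->
    (forall t, f t \in `]0, 1]) -> measurable_fun setT (phi \o f).
  move=> mf f01; apply: (measurable_comp (F := `]0, 1] : set R)) => //.
  by move=> _ [t _ <-]; exact: f01.
have mf d (T : measurableType d) (f : T -> R) : measurable_fun setT f ->
    (forall t, f t \in `]0, 1]) ->
    measurable_fun setT ((fun t => (f t * phi (f t))%:E) : T -> \bar R).
  move=> mf f01; apply/measurable_EFinP; apply: measurable_funM => //.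
  exact: mphi.
have f0 d (T : measurableType d) (f : T -> R) :
    (forall t, f t \in `]0, 1]) -> forall t, setT t -> (0 <= (f t * phi (f t))%:E)%E.
  by move=> f01 t _; rewrite lee_fin mulr_ge0// ltW ?phi_gt0 ?gt0.
set Sq := (\int[nu]_b _)%E.
have Sq0 : (0 <= Sq)%E by apply: integral_ge0 => b _; exact: f0.
(* Inner integral, with [a] fixed: write [c] as [c] times the unit mass of [q], then compare
   integrands, where the common factor [q b] cancels. *)
have cSq a : (c%:E <= (phi (p a))%:E * Sq)%E.
  have phipa := ltW (phi_gt0 _ (p01 a)).
  rewrite -[leLHS]mule1 -q1 -!ge0_integralZl_EFin//; last 4 first.
  - exact: f0.
  - exact: mf.
  - by move=> b _; rewrite lee_fin ltW ?gt0.
  - exact/measurable_EFinP.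
  apply: ge0_le_integral => //.
  - by move=> b _; rewrite -EFinM lee_fin mulr_ge0// ltW ?gt0.
  - by apply: measurable_funeM; exact/measurable_EFinP.
  - by apply: measurable_funeM; exact: mf.
  move=> b _; rewrite -!EFinM lee_fin mulrCA mulrC ler_wpM2l ?(ltW (gt0 _ (q01 b)))//.
  exact: le_trans (c_le a b) (phi_submul _ _ (p01 a) (q01 b)).
(* [Sq] may be infinite; nonnegativity alone lets it move under the outer integral. Then [c] is
   written against the unit mass of [p] and [cSq] is applied pointwise. *)
rewrite -ge0_integralZr//; last 2 first.
- exact: mf.
- exact: f0.
rewrite -[leLHS]mul1e -p1 -ge0_integralZr//; last 2 first.
- exact/measurable_EFinP.
- by move=> a _; rewrite lee_fin ltW ?gt0.
apply: ge0_le_integral => //.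
- by move=> a _; rewrite -EFinM lee_fin mulr_ge0// ltW ?gt0.
- by apply: emeasurable_funM => //; exact/measurable_EFinP.
- by apply: emeasurable_funM => //; exact: mf.
move=> a _; rewrite EFinM -muleA lee_wpmul2l// lee_fin ltW ?gt0//.
Qed.

(** * Frame coefficients as probability densities *)

Section frames.
Context (R : realType) (k : scalar_kind)
  (H : completeNormedModType (scalar_field R k)) (ip : {dot H for scalar_conj R k}).
Hypothesis ip_norm : forall h : H, `|h| ^+ 2 = ip h h.

Lemma normR_ge0 (V : normedZmodType (scalar_field R k)) (v : V) : 0 <= normR v.
Proof. by rewrite -(@ler_scalar_of R k) rmorph0 scalar_of_normR. Qed.

Lemma normR_cauchy_schwarz x y : normR (ip x y) <= normR x * normR y.
Proof.
rewrite -(@ler_scalar_of R k) rmorphM !scalar_of_normR.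
exact: (cauchy_schwarz (@mul_scalar_conj R k) ip_norm).
Qed.

Lemma normR_buzano h x y : normR h = 1 ->
  2 * (normR (ip h x) * normR (ip h y)) <= normR x * normR y + normR (ip x y).
Proof.
move=> h1; rewrite -(@ler_scalar_of R k) rmorphD !rmorphM rmorph_nat !scalar_of_normR.
(* [buzano] has [h] as second argument in its first factor. *)
rewrite (norm_ipC ip (@mul_scalar_conj R k)).
apply: (buzano (@mul_scalar_conj R k)) => //.
by rewrite -scalar_of_normR h1 rmorph1.
Qed.

Context (d : measure_display) (Omega : measurableType d)
  (mu : {measure set Omega -> \bar R}) (tau : Omega -> H).

(** The upper bound 1 comes from Cauchy-Schwarz, positivity from the nonvanishing coefficients, and
    total mass 1 from the Parseval identity at a unit vector. *)
Lemma frame_density (h : H) : continuous_parseval_frame ip mu tau ->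
  one_bounded tau -> entropy_domain ip tau h ->
  let p a := normR (ip h (tau a)) ^+ 2 in
  [/\ measurable_fun setT p, forall a, p a \in `]0, 1]
    & (\int[mu]_a (p a)%:E = 1)%E].
Proof.
move=> [mtau ptau] tau1 [h1 h0] p; split; last by rewrite -ptau h1 expr1n.
  by apply: measurable_funX; exact: measurable_normR.
move=> a; rewrite in_itv/= exprn_gt0/=; last first.
  by rewrite -(@ltr_scalar_of R k) rmorph0 scalar_of_normR normr_gt0.
rewrite exprn_ile1 ?normR_ge0// (le_trans (normR_cauchy_schwarz _ _))//.
by rewrite h1 mul1r.
Qed.

End frames.

Unset Implicit Arguments.
Set Strict Implicit.

Theorem theorem2p3 (R : realType) (k : scalar_kind)
    (H : completeNormedModType (scalar_field R k))
    (ip : {dot H for scalar_conj R k})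
    (ip_norm : forall h : H, `|h| ^+ 2 = ip h h)
    (phi : R -> R)
    (phi_gt0 : forall x, x \in `]0, 1] -> 0 < phi x)
    (phi_cont : {within `]0, 1], continuous phi})
    (phi_decr : forall x y, x \in `]0, 1] -> y \in `]0, 1] ->
      x <= y -> phi y <= phi x)
    (phi_submul : forall x y, x \in `]0, 1] -> y \in `]0, 1] ->
      phi (x * y) <= phi x * phi y)
    (dO dD : measure_display)
    (Omega : measurableType dO) (mu : {measure set Omega -> \bar R})
    (Delta : measurableType dD) (nu : {measure set Delta -> \bar R})
    (tau : Omega -> H) (omega : Delta -> H)
    (tau_frame : continuous_parseval_frame ip mu tau)
    (tau_bounded : one_bounded tau)
    (omega_frame : continuous_parseval_frame ip nu omega)
    (omega_bounded : one_bounded omega)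
    (h : H) :
  (entropy_domain ip tau `&` entropy_domain ip omega) h ->
  let s := sup [set normR (ip (tau a) (omega b)) |
                  a in [set: Omega] & b in [set: Delta]] in
  ((phi ((1 + s) ^+ 2 / 4))%:E <=
     entropy ip mu tau phi h * entropy ip nu omega phi h)%E /\
  0 <= phi ((1 + s) ^+ 2 / 4).
Proof.
move=> [dtau domega].
have [mp p01 p1] := frame_density ip_norm tau_frame tau_bounded dtau.
have [mq q01 q1] := frame_density ip_norm omega_frame omega_bounded domega.
set D := [set normR (ip (tau a) (omega b)) | a in [set: Omega] & b in [set: Delta]].
move=> s.
(* Boundedness makes [s] a genuine supremum whenever [D] is nonempty. *)
have D1 : ubound D 1.
  move=> _ [a _ [b _ <-]]; rewrite (le_trans (normR_cauchy_schwarz ip_norm _ _))//.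
  by rewrite mulr_ile1 ?normR_ge0.
have s01 : 0 <= s <= 1.
  (* For an empty [D], [sup] takes its default value 0, which is still in range. *)
  have [D0|D0] := pselect (D !=set0); last first.
    by rewrite /s sup_out ?lexx ?ler01// => -[].
  rewrite ge_sup// andbT; case: D0 => x Dx.
  have xs : x <= s by apply: ub_le_sup => //; exists 1.
  by apply: le_trans xs; case: Dx => a _ [b _ <-]; exact: normR_ge0.
(* With [s] between 0 and 1 the argument of [phi] lies between 1/4 and 1, hence in the domain of
   [phi]. *)
have sE : (1 + s) ^+ 2 / 4 \in `]0, 1] by rewrite in_itv/=; case/andP: s01; nra.
have ? := ltW (phi_gt0 _ sE); split => //.
apply: prod_entropy_ge => //.
  by apply: subspace_continuous_measurable_fun.
move=> a b; set x := normR (ip h (tau a)); set y := normR (ip h (omega b)).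
have xy0 : 0 <= x * y by rewrite mulr_ge0 ?normR_ge0.
(* Buzano and 1-boundedness give [2 * (x * y) <= 1 + s]. *)
have xys : x * y <= (1 + s) / 2.
  rewrite ler_pdivlMr// mulrC.
  apply: le_trans (normR_buzano ip_norm (tau a) (omega b) dtau.1) _.
  apply: lerD; first by rewrite mulr_ile1 ?normR_ge0.
  by apply: ub_le_sup; [exists 1|exists a => //; exists b].
have xysq : (x * y) ^+ 2 <= (1 + s) ^+ 2 / 4 by nra.
(* Since [phi] decreases, the upper bound on the product of the densities becomes a lower bound on
   its image; that product must also be seen to lie in the domain of [phi]. *)
rewrite -exprMn phi_decr// exprMn; move: (p01 a) (q01 b); rewrite !in_itv/=.
by move=> /andP[x0 x1] /andP[y0 y1]; rewrite mulr_gt0// mulr_ile1// ltW.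
Qed.
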